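(* Let $d \ge 1$, let $\omega > 1$ be a (large) fast frequency, let $U(q) = \frac12 q^T q$ and $W(q) = \frac12 q^T \Omega^2 q$ on $\mathbb{R}^d$ with $\Omega = \omega I$, and let the mass matrix be $M = I$. Then the IMEX method with time step size $h > 0$ applied to the Lagrangian $L(q,\dot q) = \frac12 \dot q^T \dot q - U(q) - W(q)$ is linearly stable if and only if $h \le 2$.
   Context: For a Lagrangian $L(q,\dot q) = \frac12 \dot q^T M \dot q - U(q) - W(q)$ on $\mathbb{R}^d$ with slow potential $U$ and fast potential $W$, the IMEX discrete Lagrangian with step size $h>0$ is $$L_h^{\mathrm{IMEX}}(q_n,q_{n+1}) = \frac h2 \left(\frac{q_{n+1}-q_n}{h}\right)^T M \left(\frac{q_{n+1}-q_n}{h}\right) - h\,\frac{U(q_n)+U(q_{n+1})}{2} - h\, W\!\left(\frac{q_n+q_{n+1}}{2}\right).$$ The IMEX method is the one-step map $(q_n,p_n)\mapsto(q_{n+1},p_{n+1})$ on $\mathbb{R}^d\times\mathbb{R}^d$ defined by $p_n = -D_1 L_h^{\mathrm{IMEX}}(q_n,q_{n+1})$, $p_{n+1} = D_2 L_h^{\mathrm{IMEX}}(q_n,q_{n+1})$, where $D_1, D_2$ are the partial derivatives in the first and second arguments; that is, $$p_n = M\frac{q_{n+1}-q_n}{h} + \frac h2 \nabla U(q_n) + \frac h2 \nabla W\!\left(\frac{q_n+q_{n+1}}2\right),\qquad p_{n+1} = M\frac{q_{n+1}-q_n}{h} - \frac h2 \nabla U(q_{n+1}) - \frac h2 \nabla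 W\!\left(\frac{q_n+q_{n+1}}2\right).$$ When $U$ and $W$ are quadratic this map is linear, and its $2d\times 2d$ matrix is called the propagation matrix. The method is called linearly stable (for given parameters) if all eigenvalues of the propagation matrix have modulus at most $1$. (With this convention, the Störmer/Verlet method for a harmonic oscillator of unit mass and frequency $\nu$ is linearly stable if and only if $|h\nu|\le 2$.) *)

(* Defs.v *)
From mathcomp Require Import all_boot all_order all_algebra.
From mathcomp Require Import complex.
From mathcomp Require Import all_classical all_reals all_analysis.

Set Implicit Arguments.
Unset Strict Implicit.
Unset Printing Implicit Defensive.

Import Order.TTheory GRing.Theory Num.Theory.
Import numFieldNormedType.Exports.

Local Open Scope ring_scope.

Definition gradient (R : realType) (d : nat) (f : 'cV[R]_d -> R)
    (x : 'cV[R]_d) : 'cV[R]_d :=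
  \col_i ('D_(delta_mx i 0) f x : R).

Definition quad_form (R : realType) (d : nat) (A : 'M[R]_d) (x : 'cV[R]_d) : R :=
  (x^T *m A *m x) 0 0.

(* Slow potential [U], fast potential [W]: trapezoidal rule for [U], midpoint
   rule for [W]. *)
Definition imex_lagrangian (R : realType) (d : nat) (M : 'M[R]_d)
    (U W : 'cV[R]_d -> R) (h : R) (q0 q1 : 'cV[R]_d) : R :=
  h / 2 * quad_form M (h^-1 *: (q1 - q0))
  - h * ((U q0 + U q1) / 2)
  - h * W (2^-1 *: (q0 + q1)).

(* The IMEX method as a relation between (q0, p0) and (q1, p1), since q1 is
   defined implicitly by the first equation. *)
Definition imex_step (R : realType) (d : nat) (M : 'M[R]_d)
    (U W : 'cV[R]_d -> R) (h : R) (q0 p0 q1 p1 : 'cV[R]_d) : Prop :=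
  p0 = - gradient (fun q => imex_lagrangian M U W h q q1) q0 /\
  p1 = gradient (fun q => imex_lagrangian M U W h q0 q) q1.

(* The equivalence says that the step relation is the graph of the linear map
   z |-> P *m z on phase space; at most one P satisfies this. *)
Definition is_propagation_matrix (R : realType) (d : nat)
    (step : 'cV[R]_d -> 'cV[R]_d -> 'cV[R]_d -> 'cV[R]_d -> Prop)
    (P : 'M[R]_(d + d)) : Prop :=
  forall q0 p0 q1 p1 : 'cV[R]_d,
    step q0 p0 q1 p1 <-> col_mx q1 p1 = P *m col_mx q0 p0.

(* Eigenvalues are taken over the complex numbers R[i]. *)
Definition linearly_stable (R : realType) (d : nat)
    (step : 'cV[R]_d -> 'cV[R]_d -> 'cV[R]_d -> 'cV[R]_d -> Prop) : Prop :=
  exists2 P : 'M[R]_(d + d), is_propagation_matrix step P &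
    forall lambda : R[i],
      eigenvalue (map_mx (real_complex R) P) lambda -> `|lambda| <= 1.

(* Main.v *)
(* With s = 1 + (h omega)^2 / 4, the step is (q, p) |-> (a q + b p, c q + a p),
   where a = (2 - s - h^2 / 2) / s, b = h / s and a^2 - b c = 1. The eigenvalues
   are the roots of (l - a)^2 = a^2 - 1, whose product is 1, so they all have
   modulus at most 1 iff -1 <= a <= 1. The upper bound always holds, and the
   fast frequency cancels from the lower one: 2 - s - h^2 / 2 >= - s says
   exactly that h^2 <= 4. *)
Require Import Defs.
From mathcomp Require Import all_boot all_order all_algebra.
From mathcomp Require Import complex.
From mathcomp Require Import all_classical all_reals all_analysis.
From mathcomp Require Import ring lra.

Import Order.TTheory GRing.Theory Num.Theory.
Import numFieldNormedType.Exports.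

Local Open Scope ring_scope.

Definition dot {R : realType} {d : nat} (x y : 'cV[R]_d) : R := (x^T *m y) 0 0.

Lemma dotE (R : realType) (d : nat) (x y : 'cV[R]_d) :
  dot x y = \sum_i x i 0 * y i 0.
Proof. by rewrite /dot mxE; apply: eq_bigr => i _; rewrite mxE. Qed.

Lemma dotC (R : realType) (d : nat) (x y : 'cV[R]_d) : dot x y = dot y x.
Proof. by rewrite !dotE; apply: eq_bigr => i _; rewrite mulrC. Qed.

Lemma dotDr (R : realType) (d : nat) (x y z : 'cV[R]_d) :
  dot x (y + z) = dot x y + dot x z.
Proof. by rewrite /dot mulmxDr mxE. Qed.

Lemma dotZr (R : realType) (d : nat) (a : R) (x y : 'cV[R]_d) :
  dot x (a *: y) = a * dot x y.
Proof. by rewrite /dot -scalemxAr mxE. Qed.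

Lemma dotDl (R : realType) (d : nat) (x y z : 'cV[R]_d) :
  dot (x + y) z = dot x z + dot y z.
Proof. by rewrite dotC dotDr !(dotC _ _ z). Qed.

Lemma dotZl (R : realType) (d : nat) (a : R) (x y : 'cV[R]_d) :
  dot (a *: x) y = a * dot x y.
Proof. by rewrite dotC dotZr dotC. Qed.

Lemma dotNr (R : realType) (d : nat) (x y : 'cV[R]_d) :
  dot x (- y) = - dot x y.
Proof. by rewrite -scaleN1r dotZr mulN1r. Qed.

Lemma dotNl (R : realType) (d : nat) (x y : 'cV[R]_d) :
  dot (- x) y = - dot x y.
Proof. by rewrite -scaleN1r dotZl mulN1r. Qed.

Lemma dot_delta (R : realType) (d : nat) (x : 'cV[R]_d) (i : 'I_d) :
  dot x (delta_mx i 0) = x i 0.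
Proof.
rewrite dotE (bigD1 i) //= big1 ?addr0 => [|j /negPf ji]; rewrite mxE eqxx.
  by rewrite eqxx mulr1.
by rewrite ji mulr0.
Qed.

Lemma quad_form_scalar (R : realType) (d : nat) (a : R) (x : 'cV[R]_d) :
  quad_form a%:M x = a * dot x x.
Proof. by rewrite /quad_form mul_mx_scalar -scalemxAl mxE. Qed.

(** When [f] is exactly quadratic along each line, its difference quotient at [t != 0] is
    [dot g v + t * m v], which tends to [dot g v]. Gradients are thus read off an algebraic
    expansion. *)
Lemma gradient_quadratic (R : realType) (d : nat) (f : 'cV[R]_d -> R)
    (x g : 'cV[R]_d) (m : 'cV[R]_d -> R) :
  (forall t v, f (t *: v + x) = f x + t * dot g v + t ^+ 2 * m v) ->
  gradient f x = g.
Proof.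
move=> fE; apply/matrixP => i j; rewrite ord1 mxE -[RHS]dot_delta.
set v := delta_mx i 0; rewrite /derive; apply: cvg_lim => //.
have gE : {near dnbhs (0 : R), (fun t : R => dot g v + t * m v) =1
                 (fun t => t^-1 *: (f (t *: v + x) - f x))}.
  near=> t; have t0 : t != 0 by near: t; exact: nbhs_dnbhs_neq.
  by rewrite fE /GRing.scale /=; field.
apply: cvg_trans (near_eq_cvg gE) _.
rewrite -[X in cvg_to _ (nbhs X)]addr0; apply: cvgD; first exact: cvg_cst.
rewrite -[X in cvg_to _ (nbhs X)](mul0r (m v)); apply: cvgMr_tmp.
exact: nbhs_dnbhs.
Unshelve. all: by end_near. Qed.

Section PropagationMatrix.
Variables (R : realType) (d : nat) (omega h : R).

Let U : 'cV[R]_d -> R := fun q => 2^-1 * (q^T *m q) 0 0.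
Let W : 'cV[R]_d -> R :=
  fun q => 2^-1 * quad_form ((omega%:M : 'M[R]_d) *m omega%:M) q.
Let L := imex_lagrangian 1%:M U W h.

(** Once every term is bilinear in [dot], the expansion needed by [gradient_quadratic] becomes a
    [field] identity. *)
Lemma imex_lagrangian_dot q0 q1 : h != 0 ->
  L q0 q1 = (2 * h)^-1 * dot (q1 - q0) (q1 - q0)
    - h / 4 * (dot q0 q0 + dot q1 q1)
    - h * omega ^+ 2 / 8 * dot (q0 + q1) (q0 + q1).
Proof.
move=> h0; rewrite /L /imex_lagrangian /U /W -scalar_mxM !quad_form_scalar.
by rewrite !dotZl !dotZr -/(dot q0 q0) -/(dot q1 q1); field.
Qed.

Lemma gradient_imex_l q0 q1 : h != 0 ->
  gradient (fun q => L q q1) q0 =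
  - (h^-1 *: (q1 - q0)) - (h / 2) *: q0 - (h * omega ^+ 2 / 4) *: (q0 + q1).
Proof.
(* The coefficient of [t ^+ 2] collects the kinetic, slow and fast contributions of the displacement
   [v]. *)
move=> h0; apply: (gradient_quadratic _ _ _ _ _
    (fun v => ((2 * h)^-1 - h / 4 - h * omega ^+ 2 / 8) * dot v v)) => t v.
rewrite !imex_lagrangian_dot //.
rewrite !(dotDl, dotDr, dotNl, dotNr, dotZl, dotZr) !(dotC _ _ v) (dotC _ _ q1 q0); by field.
Qed.

Lemma gradient_imex_r q0 q1 : h != 0 ->
  gradient (fun q => L q0 q) q1 =
  h^-1 *: (q1 - q0) - (h / 2) *: q1 - (h * omega ^+ 2 / 4) *: (q0 + q1).
Proof.
move=> h0; apply: (gradient_quadratic _ _ _ _ _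
    (fun v => ((2 * h)^-1 - h / 4 - h * omega ^+ 2 / 8) * dot v v)) => t v.
rewrite !imex_lagrangian_dot //.
rewrite !(dotDl, dotDr, dotNl, dotNr, dotZl, dotZr) !(dotC _ _ v) (dotC _ _ q1 q0); by field.
Qed.

Let s := 1 + h ^+ 2 * omega ^+ 2 / 4.
Let a := (2 - s - h ^+ 2 / 2) / s.
Let b := h / s.
(** Chosen so that [b * c = a ^+ 2 - 1] is immediate; that it is the true coefficient of the step is
    checked by [field] below. *)
Let c := (a ^+ 2 - 1) / b.

Lemma imex_propagation_matrix : 0 < h ->
  is_propagation_matrix (imex_step 1%:M U W h)
    (block_mx a%:M b%:M c%:M a%:M).
Proof.
move=> h_gt0 q0 p0 q1 p1.
have h0 : h != 0 by rewrite gt_eqF.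
(* This is [4 * s], the denominator that [field] meets. *)
have s0 : 4 + (h * omega) ^+ 2 != 0.
  by rewrite gt_eqF //; have := sqr_ge0 (h * omega); lra.
rewrite /imex_step -/L gradient_imex_l // gradient_imex_r //.
rewrite mul_block_col !mul_scalar_mx.
split.
  move=> [-> ->]; congr col_mx; apply/matrixP => i j; rewrite ord1 !mxE;
    rewrite /c /a /b /s; field; by rewrite h0 s0.
move=> /eq_col_mx[-> ->]; split; apply/matrixP => i j; rewrite ord1 !mxE;
  rewrite /c /a /b /s; field; by rewrite h0 s0.
Qed.

End PropagationMatrix.

(** Stability only asserts that some propagation matrix exists; uniqueness transfers its spectral
    bound to the explicit block matrix. *)
Lemma propagation_matrix_unique (R : realType) (d : nat)
    (step : 'cV[R]_d -> 'cV[R]_d -> 'cV[R]_d -> 'cV[R]_d -> Prop)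
    (P Q : 'M[R]_(d + d)) :
  is_propagation_matrix step P -> is_propagation_matrix step Q -> P = Q.
Proof.
move=> hP hQ; have PQ (z : 'cV_(d + d)) : P *m z = Q *m z.
  rewrite -[z]vsubmxK -[P *m _]vsubmxK; apply/hQ/hP.
  by rewrite !vsubmxK.
apply/trmx_inj/row_matrixP => i; apply: trmx_inj.
by rewrite -!tr_col !trmxK !colE.
Qed.

(** Eigenvectors are rows [(u, w)], so the equations are [b *: u = (l - a) *: w] and
    [c *: w = (l - a) *: u]. Eliminating [u] multiplies [w] by [(l - a) ^+ 2 - b * c]; if this is
    nonzero, [w] vanishes, and then so does [u]. *)
Lemma eigenvalue_scalar_block (F : fieldType) (d : nat) (a b c l : F) :
  (0 < d)%N -> b != 0 ->
  eigenvalue (block_mx a%:M b%:M c%:M a%:M : 'M[F]_(d + d)) l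
  = ((l - a) ^+ 2 == b * c).
Proof.
move=> d0 b0; apply/eigenvalueP/eqP => [[v]|lE].
  rewrite -[v]hsubmxK; move: (lsubmx v) (rsubmx v) => u w.
  rewrite mul_row_block !mul_mx_scalar scale_row_mx => /eq_row_mx[uE wE].
  have bu : b *: u = (l - a) *: w.
    by rewrite scalerBl -wE addrK.
  have cw : c *: w = (l - a) *: u.
    by rewrite scalerBl -uE addrC addKr.
  apply: contraNeq => ne; have w0 : w = 0.
    apply/eqP; have : ((l - a) ^+ 2 - b * c) *: w == 0.
      by rewrite scalerBl -!scalerA cw -bu !scalerA mulrC subrr.
    by rewrite scaler_eq0 subr_eq0 (negPf ne).
  rewrite w0 in bu *; move/eqP: bu.
  by rewrite scaler0 scaler_eq0 (negPf b0) /= => /eqP->; rewrite row_mx0.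
case: d d0 => // d _.
(* Take [w] with all entries 1 and solve the first equation for [u]. *)
exists (row_mx (((l - a) / b) *: const_mx 1) (const_mx 1)).
  rewrite mul_row_block !mul_mx_scalar scale_row_mx; congr row_mx;
    apply/matrixP => i j; rewrite !mxE ?mulr1.
    have -> : c = (l - a) ^+ 2 / b by rewrite lE; field.
    by field.
  by field.
apply/eqP => /(congr1 (fun M => rsubmx M 0 0)).
by rewrite row_mxKr linear0 !mxE => /eqP; rewrite oner_eq0.
Qed.

(** Since [a ^+ 2 - 1 <= 0], the number [l - a] is purely imaginary with squared modulus
    [1 - a ^+ 2], so [l] lies on the unit circle. *)
Lemma normc_le1_root (R : realType) (a : R) (l : R[i]) :
  -1 <= a <= 1 -> (l - a%:C%C) ^+ 2 = (a ^+ 2 - 1)%:C%C -> `|l| <= 1.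
Proof.
move=> a1; case: l => x y /eqP.
rewrite expr2 eq_complex /= => /andP[/eqP re /eqP im].
have a2 : a ^+ 2 <= 1 by nra.
(* The imaginary part gives [(x - a) * y = 0]; if [x != a], then [y = 0] and a positive square would
   equal [a ^+ 2 - 1]. *)
have xa : x = a.
  apply/eqP; rewrite -subr_eq0; apply/negPn/negP => xa.
  have y0 : y = 0 by apply: (mulfI xa); rewrite mulr0; lra.
  have := exprn_even_gt0 (n := 2) (x - a) => /(_ isT); rewrite xa /= => xa2.
  by move: re; rewrite y0; nra.
rewrite normc_def /= (_ : x ^+ 2 + y ^+ 2 = 1) ?sqrtr1 //.
by move: re; rewrite xa; nra.
Qed.

Theorem theorem2p3 (R : realType) (d : nat) (omega h : R) :
  (1 <= d)%N -> 1 < omega -> 0 < h ->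
  let Omega : 'M[R]_d := omega%:M in
  let U : 'cV[R]_d -> R := fun q => 2^-1 * (q^T *m q) 0 0 in
  let W : 'cV[R]_d -> R := fun q => 2^-1 * quad_form (Omega *m Omega) q in
  linearly_stable (imex_step 1%:M U W h) <-> h <= 2.
Proof.
move=> d1 _ h_gt0 Omega U W.
have := @imex_propagation_matrix R d omega h h_gt0.
set s := 1 + _; set a := _ / s; set b := h / s; set c := _ / b.
set P := block_mx _ _ _ _ => HP.
have s_ge1 : 1 <= s by rewrite /s -exprMn; have := sqr_ge0 (h * omega); lra.
have s_gt0 : 0 < s by lra.
have b0 : b != 0 by rewrite gt_eqF ?divr_gt0.
have eigP l : eigenvalue (map_mx (real_complex R) P) l =
    ((l - a%:C%C) ^+ 2 == (a ^+ 2 - 1)%:C%C).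
  rewrite map_block_mx !map_scalar_mx eigenvalue_scalar_block //; last first.
    by rewrite fmorph_eq0.
  by rewrite -rmorphM /= [b * c]mulrC divfK.
split=> [[Q /(propagation_matrix_unique _ _ _ _ _)/(_ HP) -> stable]|h2].
  rewrite leNgt; apply/negP => h2.
  have aN1 : a < -1 by rewrite ltr_pdivrMr //; nra.
  have a2 : 0 <= a ^+ 2 - 1 by nra.
  (* The smaller of the two real eigenvalues: [r <= a < -1], so its modulus exceeds 1. *)
  set r := a - Num.sqrt (a ^+ 2 - 1).
  have := stable r%:C%C; rewrite eigP -rmorphB -rmorphXn /=.
  rewrite (_ : (r - a) ^+ 2 = a ^+ 2 - 1) ?eqxx; last first.
    by rewrite /r addrC addKr sqrrN sqr_sqrtr.
  move=> /(_ isT); rewrite normc_def /= expr0n addr0 sqrtr_sqr.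
  rewrite -[1]/(1%:C%C) lecR ler_norml => /andP[].
  by rewrite /r; have := sqrtr_ge0 (a ^+ 2 - 1); lra.
exists P => // l; rewrite eigP => /eqP; apply: normc_le1_root.
by rewrite ler_pdivlMr // ler_pdivrMr //; apply/andP; split; nra.
Qed.
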